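(* Let $(\mathcal S,\gamma)$ be a normalized IFS path in $\mathbb{R}^2$, $\mathcal S=\{S_1,\dots,S_N\}$, such that (1) $S_1$ and $S_N$ are orientation preserving; (2) there exist $t,s\in\mathbb{N}$ with $r_1^t=r_N^s$ and $t\alpha_1-s\alpha_N\in 2\pi(\mathbb{R}\setminus\mathbb{Q})$; (3) there exists $i\in\{1,\dots,N-1\}$ such that (a) $S_i$ and $S_{i+1}$ are either both orientation preserving or both orientation reversing, and (b) there is no rotation around the point $S_i(\mathbf e_1)=S_{i+1}(0)$ that maps $S_i(\gamma)$ into $S_{i+1}(\gamma)$, and no such rotation mapping $S_{i+1}(\gamma)$ into $S_i(\gamma)$. Then $(\mathcal S,\gamma)$ is not an IFS arc.
   Context: Let $\mathcal S=\{S_1,\dots,S_N\}$, $N\ge2$, be contracting similarities of $\mathbb{R}^2$, $S_j(x)=r_jA_j(x)+b_j$ with $r_j\in(0,1)$, $A_j$ orthogonal. Write $A_j=R_{\alpha_j}\circ I_j$ where $R_{\alpha_j}$ is counterclockwise rotation by $\alpha_j\in[0,2\pi)$ and $I_j$ is the identity or reflection in the $x$-axis; for orientation-preserving $S_j$, $A_j=R_{\alpha_j}$. The invariant set $\gamma$ is the unique nonempty compact set with $\gamma=\bigcup_jS_j(\gamma)$. $(\mathcal S,\gamma)$ is a normalized IFS path if $S_1(0)=0$, $S_N(\mathbf e_1)=\mathbf e_1$ with $\mathbf e_1=(1,0)$, and $S_j(\mathbf e_1)=S_{j+1}(0)$ for $j=1,\dots,N-1$. It is an IFS arc if moreover $S_j(\gamma)\cap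 S_{j+1}(\gamma)=\{S_{j+1}(0)\}$ for $j=1,\dots,N-1$ and $S_j(\gamma)\cap S_k(\gamma)=\emptyset$ for $j,k\in\{1,\dots,N\}$, $|j-k|>1$. *)

(* Defs.v *)
From HB Require Import structures.
From mathcomp Require Import all_boot all_order all_algebra.
From mathcomp Require Import all_classical all_reals all_analysis.
Set Implicit Arguments. Unset Strict Implicit. Unset Printing Implicit Defensive.
Import Order.TTheory GRing.Theory Num.Theory.
Local Open Scope classical_set_scope.
Local Open Scope ring_scope.

Section Plane.
Variable R : realType.
Local Notation pt := (R^o * R^o)%type.

Definition origin : pt := (0, 0).
Definition e1 : pt := (1, 0).

Definition rot (a : R) (x : pt) : pt :=
  (cos a * x.1 - sin a * x.2, sin a * x.1 + cos a * x.2).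

Definition reflx (x : pt) : pt := (x.1, - x.2).

Definition rot_about (p : pt) (a : R) (x : pt) : pt :=
  let y := rot a (x.1 - p.1, x.2 - p.2) in (p.1 + y.1, p.2 + y.2).

Definition simil (r a : R) (f : bool) (b : pt) (x : pt) : pt :=
  let y := rot a (if f then reflx x else x) in (r * y.1 + b.1, r * y.2 + b.2).

(* An IFS S_1..S_N given by data r_j, alpha_j, refl_j (true = orientation
   reversing), b_j; indices j range over 1..N. *)
Definition Sim (r alpha : nat -> R) (refl : nat -> bool) (b : nat -> pt) (j : nat) :=
  simil (r j) (alpha j) (refl j) (b j).

Definition is_IFS (N : nat) (r alpha : nat -> R) : Prop :=
  (2 <= N)%N /\
  forall j, (1 <= j <= N)%N -> 0 < r j < 1 /\ 0 <= alpha j < 2 * pi.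

(* gamma is the invariant set: nonempty, compact, gamma = U_j S_j(gamma)
   (such a set is unique by Hutchinson's theorem). *)
Definition is_invariant_set (N : nat) (r alpha : nat -> R) (refl : nat -> bool)
    (b : nat -> pt) (gamma : set pt) : Prop :=
  gamma !=set0 /\ compact gamma /\
  gamma = [set y | exists j, (1 <= j <= N)%N /\ (Sim r alpha refl b j @` gamma) y].

Definition normalized_IFS_path (N : nat) (r alpha : nat -> R) (refl : nat -> bool)
    (b : nat -> pt) (gamma : set pt) : Prop :=
  is_IFS N r alpha /\ is_invariant_set N r alpha refl b gamma /\
  Sim r alpha refl b 1 origin = origin /\
  Sim r alpha refl b N e1 = e1 /\
  (forall j, (1 <= j < N)%N -> Sim r alpha refl b j e1 = Sim r alpha refl b j.+1 origin).

Definition IFS_arc (N : nat) (r alpha : nat -> R) (refl : nat -> bool)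
    (b : nat -> pt) (gamma : set pt) : Prop :=
  normalized_IFS_path N r alpha refl b gamma /\
  (forall j, (1 <= j < N)%N ->
     (Sim r alpha refl b j @` gamma) `&` (Sim r alpha refl b j.+1 @` gamma)
       = [set Sim r alpha refl b j.+1 origin]) /\
  (forall j k, (1 <= j <= N)%N -> (1 <= k <= N)%N -> (j.+1 < k)%N \/ (k.+1 < j)%N ->
     (Sim r alpha refl b j @` gamma) `&` (Sim r alpha refl b k @` gamma) = set0).

End Plane.

(* Main.v *)
Require Import Defs.
From HB Require Import structures.
From mathcomp Require Import all_boot all_order all_algebra.
From mathcomp Require Import all_classical all_reals all_analysis.
From mathcomp Require Import ring lra zify.
Import Order.TTheory GRing.Theory Num.Theory.
Import numFieldNormedType.Exports.
Local Open Scope classical_set_scope.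
Local Open Scope ring_scope.

(** Near the point [p = S_i(e1) = S_{i+1}(0)] the set [S_i(gamma) - p] is mapped into
    itself by the similarity with ratio [r_N] and angle [+-alpha_N], and
    [S_{i+1}(gamma) - p] by the one with ratio [r_1] and angle [+-alpha_1], the signs being
    equal by (3a). For an arc the pieces of these sets away from [p] lift to log-polar
    coordinates, where they become connected sets joining a point to its translate by
    [(ln r_N, a)], resp. [(ln r_1, c)], with [a] and [c] lifts of the two angles. Since
    [r_1^t = r_N^s] and [t alpha_1 - s alpha_N] is not a multiple of [2 pi], the two periodic
    curves drift at different vertical rates as the real part tends to [-oo]. After lifting
    one of them by a large multiple of [2 pi] it starts above the other and ends below it, so
    they cross: the two sets meet outside [p]. Connectedness is expressed by [epsilon]-chains,
    and the crossing is obtained from a Sperner-type parity count. *)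

(** * A discrete Stokes argument modulo 2 on a rectangular grid *)

(** The cell condition says that [h] and [v] form a closed cochain modulo 2, which therefore has a
    potential. This potential is constant along the bottom and right sides and equals [u] along the
    left and top sides, so both corner values are read off from it. *)
Lemma grid_parity (P Q : nat) (h v u : nat -> nat -> bool) :
  (forall i j, (i < P)%N -> (j < Q)%N ->
     h i j (+) v i.+1 j = v i j (+) h i j.+1) ->
  (forall i, (i < P)%N -> h i 0%N = false) ->
  (forall j, (j < Q)%N -> v P j = false) ->
  (forall j, (j < Q)%N -> v 0%N j = u 0%N j (+) u 0%N j.+1) ->
  (forall i, (i < P)%N -> h i Q = u i Q (+) u i.+1 Q) ->
  u 0%N 0%N = u P Q.
Proof.
move=> cell h0 vP v0 hQ.
(* The potential: [u] on the left side, then a sum of [h] along row [j]. *)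
pose g i j := u 0%N j (+) \big[addb/false]_(k < i) h k j.
have gS i j : g i.+1 j = g i j (+) h i j by rewrite /g big_ord_recr addbA.
have gV i j : (i <= P)%N -> (j < Q)%N -> g i j (+) g i j.+1 = v i j.
  move=> iP jQ; elim: i iP => [_|i IH iP].
    by rewrite v0// /g !big_ord0 !addbF.
  have := cell i j iP jQ; have := IH (ltnW iP).
  by rewrite !gS; case: (g i j) (g i j.+1) (h i j) (h i j.+1) (v i j)
    (v i.+1 j) => [] [] [] [] [] [].
have g0 i : (i <= P)%N -> g i 0%N = u 0%N 0%N.
  elim: i => [_|i IH iP]; first by rewrite /g big_ord0 addbF.
  by rewrite gS h0// addbF IH// ltnW.
have gP j : (j <= Q)%N -> g P j = u 0%N 0%N.
  elim: j => [_|j IH jQ]; first exact: g0.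
  by have := gV P j (leqnn P) jQ; rewrite vP// IH 1?ltnW//; case: (g P _) (u _ _) => [] [].
have gQ i : (i <= P)%N -> g i Q = u i Q.
  elim: i => [_|i IH iP]; first by rewrite /g big_ord0 addbF.
  by rewrite gS hQ// IH 1?ltnW// addbA addbb.
by rewrite -(gP Q (leqnn Q)) gQ.
Qed.

(** * Epsilon-chains and compactness *)

Definition epsilon_chain {R : realType} {T : pseudoMetricType R} (Y : set T) (e : R)
    (x y : T) :=
  exists n (p : nat -> T), [/\ p 0%N = x, p n = y,
    forall i, (i <= n)%N -> Y (p i) & forall i, (i < n)%N -> ball (p i) e (p i.+1)].

Section Chains.
Context {R : realType} {T : pseudoMetricType R}.
Implicit Types (Y Z : set T) (x y z : T) (e : R).

Lemma epsilon_chain_step Y e x y : Y x -> Y y -> ball x e y -> epsilon_chain Y e x y.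
Proof.
move=> Yx Yy xy; exists 1%N, (fun i => if i is 0%N then x else y).
by split=> // -[|i].
Qed.

Lemma epsilon_chain_sub Y Z e x y :
  Y `<=` Z -> epsilon_chain Y e x y -> epsilon_chain Z e x y.
Proof. by move=> YZ [n [p [p0 pn pY pe]]]; exists n, p; split=> // i /pY /YZ. Qed.

Lemma epsilon_chain_trans Y e x y z :
  epsilon_chain Y e x y -> epsilon_chain Y e y z -> epsilon_chain Y e x z.
Proof.
move=> [n [p [p0 pn pY pe]]] [m [q [q0 qm qY qe]]].
exists (n + m)%N, (fun i => if (i <= n)%N then p i else q (i - n)%N); split=> //.
- case: ifPn => [|_]; last by rewrite addKn.
  by rewrite -[leqRHS]addn0 leq_add2l leqn0 => /eqP m0; rewrite m0 addn0 pn -q0 -m0 qm.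
- by move=> i inm; case: ifP => [/pY//|_]; apply: qY; rewrite leq_subLR.
- move=> i inm; case: (ltngtP i n) => [lin|gin|in_m].
  + exact: pe.
  + by rewrite subSn ?(ltnW gin)//; apply: qe; rewrite ltn_subLR// ltnW.
  + by rewrite in_m pn -q0 subSn// subnn; apply: qe; lia.
Qed.

Lemma epsilon_chain_sym Y e x y : epsilon_chain Y e x y -> epsilon_chain Y e y x.
Proof.
move=> [n [p [p0 pn pY pe]]]; exists n, (fun i => p (n - i)%N); split.
- by rewrite subn0.
- by rewrite subnn.
- by move=> i _; apply: pY; rewrite leq_subr.
- move=> i lin; apply: ball_sym.
  have -> : (n - i)%N = (n - i.+1).+1 by lia.
  by apply: pe; lia.
Qed.

End Chains.

Lemma epsilon_chain_image {R : realType} {T U : pseudoMetricType R} (Y : set T)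
    (f : T -> U) (d e : R) (x y : T) :
  (forall u v, Y u -> Y v -> ball u d v -> ball (f u) e (f v)) ->
  epsilon_chain Y d x y -> epsilon_chain (f @` Y) e (f x) (f y).
Proof.
move=> fde [n [p [p0 pn pY pd]]]; exists n, (f \o p); split => /=.
- by rewrite p0.
- by rewrite pn.
- by move=> i /pY ?; exists (p i).
- by move=> i lin; apply: fde; [apply: pY; exact: ltnW|exact: pY|exact: pd].
Qed.

(** Heine-Cantor through near coverings, the parameter being a radius tending to [0] from the right.
    Continuity is asked at the points of [K] only, because a branch of the logarithm is controlled
    only on a half-plane. *)
Lemma compact_unif_continuous {R : realType} {T U : pseudoMetricType R} (K : set T)
    (f : T -> U) :
  compact K -> (forall x, K x -> {for x, continuous f}) ->
  forall e : R, 0 < e -> exists2 d : R, 0 < d &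
    forall x y, K x -> K y -> ball x d y -> ball (f x) e (f y).
Proof.
move=> /compact_near_coveringP cK fc e e0.
have := cK _ (0^'+) (fun d x => forall y, ball x d y -> ball (f x) e (f y)) _.
case.
  move=> x Kx.
  have /fc/cvg_ball/(_ (e / 2)) : K x by [].
  rewrite divr_gt0// => /(_ erefl); rewrite near_simpl => /nbhs_ballP[r /= r0 rf].
  have r2 : 0 < r / 2 by rewrite divr_gt0.
  exists (ball x (r / 2), [set d : R | d < r / 2]) => /=.
    split; first exact: nbhsx_ballx.
    by apply: nbhs_right_lt.
  move=> [x' d] /= [xx' dr] y x'y.
  rewrite (splitr e); apply: (@ball_triangle _ _ (f x)).
    by apply/ball_sym; apply: rf; apply: le_ball xx'; lra.
  apply: rf; rewrite /= (splitr r); apply: ball_triangle xx' _.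
  by apply: le_ball x'y; exact: ltW.
move=> d /= d0 Hd.
exists (d / 2); first by rewrite divr_gt0.
move=> x y Kx _; apply: Hd => //=; last by rewrite divr_gt0.
by rewrite sub0r normrN gtr0_norm ?divr_gt0// ltr_pdivrMr// ltr_pMr// ltr1n.
Qed.

(** Disjoint compact sets have positive distance: distinct points are separated by balls, and a near
    covering of the product makes the separation uniform. This turns approximate crossings into an
    exact one. *)
Lemma compact_meet {R : realType} {T : pseudoMetricType R} (A B : set T) :
  hausdorff_space T -> compact A -> compact B ->
  (forall e : R, 0 < e -> exists x y, [/\ A x, B y & ball x e y]) ->
  A `&` B !=set0.
Proof.
move=> hT cA cB near_AB; apply: contrapT => AB0.
have /compact_near_coveringP cAB := compact_setX cA cB.
have := cAB _ (0^'+) (fun d z => ~ ball z.1 d z.2) _.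
case.
  move=> [x y] [/= Ax By].
  have xy : x != y by apply/eqP => xy; apply: AB0; exists x; split=> //; rewrite xy.
  move: hT; rewrite ball_hausdorff => /(_ _ _ xy)[[r s]] /= /eqP rs0.
  have r2 : 0 < r%:num / 2 :> R by [].
  exists (ball x (r%:num / 2) `*` ball y s%:num, [set d : R | d < r%:num / 2]) => /=.
    split; last exact: nbhs_right_lt.
    by exists (ball x (r%:num / 2), ball y s%:num) => //; split; exact: nbhsx_ballx.
  move=> [[x' y'] d] /= [[xx' yy'] dr] x'y'.
  suff : (ball x r%:num `&` ball y s%:num) y' by rewrite rs0.
  split=> //; rewrite (splitr r%:num); apply: ball_triangle xx' _.
  by apply: le_ball x'y'; exact: ltW.
move=> d /= d0 Hd.
have d20 : 0 < d / 2 by rewrite divr_gt0.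
have [x [y [Ax By xy]]] := near_AB _ d20.
have := Hd (d / 2) _ d20 (x, y) (conj Ax By); apply => //=.
by rewrite sub0r normrN gtr0_norm// ltr_pdivrMr// ltr_pMr// ltr1n.
Qed.

(** * A Sperner-type lemma for zeros of a discrete plane map *)

Section GridZero.
Context {R : realType}.
Implicit Types (p q s : R * R) (e : R).

(** Three Sperner labels: [up], [right_], and neither, the last being the closed third quadrant. An
    [edge] is a door in the sense of Sperner's lemma. *)
Let up p := 0 < p.2.
Let right_ p := ~~ up p && (0 < p.1).
Let edge p q := up p && right_ q || right_ p && up q.
Let small e p := `|p.1| < e /\ `|p.2| < e.

Let smallC e p q : small e (p - q) -> small e (q - p).
Proof. by rewrite /small /= distrC [`|p.2 - _|]distrC. Qed.

(** If three close points carried all three labels, the one that is neither [up] nor [right_] would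
    be [small]. So at most two labels occur, and the number of doors is even. *)
Let triangle e p q s : ~ small e p -> ~ small e q -> ~ small e s ->
  small e (p - q) -> small e (q - s) -> small e (p - s) ->
  edge p q (+) edge q s = edge p s.
Proof.
have no_left u v w : small e (u - w) -> small e (v - w) -> ~ small e w ->
    ~~ [&& up u, right_ v, ~~ up w & ~~ right_ w].
  rewrite /right_ /up /small /= !ltr_norml.
  move=> [/andP[? ?] /andP[? ?]] [/andP[? ?] /andP[? ?]] nw.
  apply/negP => /and4P[u2 /andP[v2 v1] w2]; rewrite w2 -leNgt => w1.
  by apply: nw; rewrite -leNgt in w2; split; lra.
have up_right u : ~~ (up u && right_ u) by rewrite /right_ andbA andbN.
move=> np nq ns pq qs ps.
have [qp sq sp] := And3 (smallC _ _ _ pq) (smallC _ _ _ qs) (smallC _ _ _ ps).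
move: (no_left _ _ _ ps qs ns) (no_left _ _ _ qs ps ns) (no_left _ _ _ pq sq nq)
  (no_left _ _ _ sq pq nq) (no_left _ _ _ qp sp np) (no_left _ _ _ sp qp np)
  (up_right p) (up_right q) (up_right s).
rewrite /edge.
by case: (up p) (up q) (up s) (right_ p) (right_ q) (right_ s) => [] [] [] [] [] [].
Qed.

(** The closed third quadrant is excluded, so every change of [up] is a door. *)
Let edge_left p q : 0 < p.1 \/ 0 < p.2 -> 0 < q.1 \/ 0 < q.2 ->
  edge p q = up p (+) up q.
Proof.
rewrite /edge /right_ /up => /orP + /orP.
by case: (0 < p.1) (0 < p.2) (0 < q.1) (0 < q.2) => [] [] [] [].
Qed.

Let edge_bottom p q : p.1 < 0 \/ 0 < p.2 -> q.1 < 0 \/ 0 < q.2 -> edge p q = false.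
Proof.
have right_F s : s.1 < 0 \/ 0 < s.2 -> right_ s = false.
  by rewrite /right_ /up => -[/lt_gtF -> | ->]; rewrite ?andbF.
by move=> /right_F p0 /right_F q0; rewrite /edge p0 q0 andbF.
Qed.

(** An [up] point has negative abscissa here; a close [right_] neighbour would make it [small]. *)
Let edge_right e p q : p.1 < 0 \/ p.2 < 0 -> q.1 < 0 \/ q.2 < 0 ->
  ~ small e p -> ~ small e q -> small e (p - q) -> edge p q = false.
Proof.
have up_right s u : s.1 < 0 \/ s.2 < 0 -> ~ small e s -> small e (s - u) ->
    up s && right_ u = false.
  rewrite /small /right_ /up /= !ltr_norml -leNgt => s0 ns [/andP[? ?] /andP[? ?]].
  apply/negP => /and3P[s2 u2 u1]; apply: ns.
  by case: s0 => s0; [split; lra|have := lt_trans s0 s2; rewrite ltxx].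
move=> p0 q0 np nq pq; rewrite /edge (up_right p q)// andbC (up_right q p)//.
exact: smallC.
Qed.

(** An [up] point has positive abscissa here, so a close neighbour that is neither [up] nor [right_]
    would be [small]. *)
Let edge_top e p q : 0 < p.1 \/ p.2 < 0 -> 0 < q.1 \/ q.2 < 0 ->
  ~ small e p -> ~ small e q -> small e (p - q) -> edge p q = up p (+) up q.
Proof.
have up_right s u : 0 < s.1 \/ s.2 < 0 -> ~ small e u -> small e (s - u) ->
    up s -> ~~ up u -> right_ u.
  rewrite /small /right_ /up /= => s0 nu su s2 u2; rewrite u2 ltNge; apply/negP => u1.
  apply: nu; move: su; rewrite -leNgt in u2; rewrite !ltr_norml.
  move=> [/andP[? ?] /andP[? ?]].
  by case: s0 => s0; [split; lra|have := lt_trans s0 s2; rewrite ltxx].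
move=> p0 q0 np nq pq; have := up_right p q p0 nq pq; have := up_right q p q0 np (smallC _ _ _ pq).
rewrite /edge /right_; case: (up p) (up q) => [] [] //= H1 H2.
- by rewrite H2.
- by rewrite H1.
- by rewrite andbF.
Qed.

(** Each side of the grid avoids a different closed quadrant, so the boundary winds once around the
    origin. Without a [small] value the parity count would give two opposite corners the same [up]
    label, whereas the side conditions force different ones. *)
Lemma grid_zero (P Q : nat) (z : nat -> nat -> R * R) (e : R) :
  (forall i j, (i < P)%N -> (j <= Q)%N -> small (e / 2) (z i j - z i.+1 j)) ->
  (forall i j, (i <= P)%N -> (j < Q)%N -> small (e / 2) (z i j - z i j.+1)) ->
  (forall j, (j <= Q)%N -> 0 < (z 0%N j).1 \/ 0 < (z 0%N j).2) ->
  (forall i, (i <= P)%N -> (z i 0%N).1 < 0 \/ 0 < (z i 0%N).2) ->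
  (forall i, (i <= P)%N -> 0 < (z i Q).1 \/ (z i Q).2 < 0) ->
  (forall j, (j <= Q)%N -> (z P j).1 < 0 \/ (z P j).2 < 0) ->
  exists i j, [/\ (i <= P)%N, (j <= Q)%N & small e (z i j)].
Proof.
move=> stepP stepQ left_ bottom top right_side; apply: contrapT => nsmall.
have nz i j : (i <= P)%N -> (j <= Q)%N -> ~ small e (z i j).
  by move=> iP jQ ?; apply: nsmall; exists i, j.
have small2 p : small (e / 2) p -> small e p.
  by rewrite /small !ltr_norml => -[/andP[? ?] /andP[? ?]]; split; apply/andP; lra.
have smallD p q s : small (e / 2) (p - q) -> small (e / 2) (q - s) -> small e (p - s).
  move: p q s => [p1 p2] [q1 q2] [s1 s2]; rewrite /small /= !ltr_norml.
  by move=> [/andP[? ?] /andP[? ?]] [/andP[? ?] /andP[? ?]]; split; apply/andP; lra.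
have [u0 uP] : up (z 0%N 0%N) /\ ~~ up (z P Q).
  rewrite /up -leNgt; split.
    have := left_ 0%N (leq0n _); have := bottom 0%N (leq0n _).
    by move=> ? ?; lra.
  have := top P (leqnn _); have := right_side Q (leqnn _).
  by move=> ? ?; lra.
suff : up (z 0%N 0%N) = up (z P Q) by rewrite u0 (negbTE uP).
apply: (@grid_parity P Q (fun i j => edge (z i j) (z i.+1 j))
  (fun i j => edge (z i j) (z i j.+1)) (fun i j => up (z i j)))
  => [i j iP jQ|i iP|j jQ|j jQ|i iP].
(* The cell is cut into two triangles, and both sides of the equation equal the [edge] along the
   diagonal. Steps below [e / 2] keep the diagonal below [e]. *)
- rewrite (@triangle e) ?(@triangle e)//; try (by apply: nz; lia);
    try (by apply: small2; first [apply: stepP|apply: stepQ]; lia).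
  + by apply: smallD; [apply: stepP|apply: stepQ]; lia.
  + by apply: smallD; [apply: stepQ|apply: stepP]; lia.
- by apply: edge_bottom; apply: bottom => //; exact: ltnW.
- have jQ' := ltnW jQ.
  by apply: (@edge_right e); [exact: right_side|exact: right_side|exact: nz|exact: nz|
    exact/small2/stepQ].
- by apply: edge_left; apply: left_ => //; exact: ltnW.
- have iP' := ltnW iP.
  by apply: (@edge_top e); [exact: top|exact: top|exact: nz|exact: nz|exact/small2/stepP].
Qed.

End GridZero.

(** * Periodic curves in log-polar coordinates *)

Definition translate {R : realType} (x l : R^o * R^o) (n : nat) : R^o * R^o :=
  (x.1 + n%:R * l.1, x.2 + n%:R * l.2).

Definition spiral {R : realType} (Y : set (R^o * R^o)) (l : R^o * R^o) (n : nat) :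
    set (R^o * R^o) :=
  [set z | exists k x, [/\ (k < n)%N, Y x & z = translate x l k]].

Section Spirals.
Context {R : realType}.
Local Notation pt := (R^o * R^o)%type.
Implicit Types (x y l : pt) (Y : set pt).

Lemma ball_planeE x y (e : R) :
  ball x e y = (`|x.1 - y.1| < e /\ `|x.2 - y.2| < e) :> Prop.
Proof. by []. Qed.

Lemma translateD x l m n : translate (translate x l m) l n = translate x l (m + n).
Proof. by rewrite /translate /= natrD !mulrDl !addrA. Qed.

Lemma translate0 x l : translate x l 0 = x.
Proof. by case: x => ? ?; rewrite /translate /= !mul0r !addr0. Qed.

Lemma ball_translate x y l n (e : R) :
  ball x e y -> ball (translate x l n) e (translate y l n).
Proof. by rewrite !ball_planeE /= !opprD !(addrACA _ _ (- _)) !subrr !addr0. Qed.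

Lemma continuous_translate l n : continuous (fun x : pt => translate x l n).
Proof.
move=> x; apply/cvg_ballP => e e0.
suff : nbhs (x : pt) (fun z : pt => ball (translate x l n) e (translate z l n)) by [].
by apply/nbhs_ballP; exists e => // z; exact: ball_translate.
Qed.

Lemma compact_translate Y l n : compact Y -> compact ((fun x => translate x l n) @` Y).
Proof.
move=> cY; apply: continuous_compact => //; apply: continuous_subspaceT.
exact: continuous_translate.
Qed.

Lemma spiralS Y l n :
  spiral Y l n.+1 = spiral Y l n `|` (fun x => translate x l n) @` Y.
Proof.
apply/seteqP; split=> z /=.
  move=> [k [x [kn Yx ->]]]; have := kn; rewrite ltnS leq_eqVlt => /orP[/eqP->|lkn].
    by right; exists x.
  by left; exists k, x.
move=> [[k [x [kn Yx ->]]]|[x Yx <-]]; last by exists n, x.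
by exists k, x; split=> //; exact: ltnW.
Qed.

Lemma compact_spiral Y l n : compact Y -> compact (spiral Y l n).
Proof.
move=> cY; elim: n => [|n IH].
  suff -> : spiral Y l 0 = set0 by exact: compact0.
  by apply/seteqP; split=> // z [k [x []]].
by rewrite spiralS; apply: compactU => //; exact: compact_translate.
Qed.

Lemma epsilon_chain_spiral Y l x (e : R) n :
  epsilon_chain Y e x (translate x l 1) ->
  epsilon_chain (spiral Y l n.+1) e x (translate x l n.+1).
Proof.
move=> Yx; have step m : epsilon_chain ((fun x => translate x l m) @` Y) e
    (translate x l m) (translate x l m.+1).
  rewrite -addn1 addnC -translateD.
  by apply: epsilon_chain_image Yx => u v _ _; exact: ball_translate.
elim: n => [|n IH].
  apply: (@epsilon_chain_sub _ _ Y) => // z Yz.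
  by exists 0%N, z; rewrite translate0.
rewrite spiralS; apply: (@epsilon_chain_trans _ _ _ _ _ (translate x l n.+1)).
  by apply: epsilon_chain_sub IH => z; left.
by apply: epsilon_chain_sub (step _) => z; right.
Qed.

(** Translate [j] of block [k] is translate [j + m * k]. This permits replacing a period by a
    multiple of it. *)
Lemma spiral_spiral Y l m n :
  spiral (spiral Y l m) (m%:R * l.1, m%:R * l.2) n `<=` spiral Y l (m * n).
Proof.
move=> z [k [x [kn [j [y [jm Yy ->]]] ->]]].
exists (j + m * k)%N, y; split=> //; first by nia.
by rewrite /translate /= natrD natrM; congr (_, _); ring.
Qed.

Lemma natr_unbounded (a c : R) : 0 < a -> exists n : nat, c < n%:R * a.
Proof.
move=> a0; exists (Num.truncn (`|c| / a)).+1.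
rewrite -ltr_pdivrMr//; apply: le_lt_trans (truncnS_gt _).
by rewrite ler_pM2r ?invr_gt0// ler_norm.
Qed.

(* In log-polar coordinates the sets [spiral YA lA n] and [spiral YB lB n] drift
   to the left at the same rate but vertically at different rates. Lifting one
   copy by a large multiple of the period [c], it starts above the other one
   and ends below it. *)
Lemma spirals_meet (YA YB : set pt) (lA lB x y : pt) (c : R) :
  compact YA -> compact YB -> 0 < c ->
  (forall e : R, 0 < e -> epsilon_chain YA e x (translate x lA 1)) ->
  (forall e : R, 0 < e -> epsilon_chain YB e y (translate y lB 1)) ->
  lA.1 < 0 -> lB.1 = lA.1 -> lA.2 < lB.2 ->
  exists n k p q, [/\ spiral YA lA n p, spiral YB lB n q, p.1 = q.1 &
    p.2 + k%:R * c = q.2].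
Proof.
move=> cA cB c0 chA chB lA0 lBA lt_lAB.
have subl (u v w : R) : u - w - (v - w) = u - v by ring.
have subl2 (u v w k : R) : u + k - w - (v + k - w) = u - v by ring.
have subr (u v w : R) : w - u - (w - v) = v - u by ring.
have bounded Y : compact Y -> exists2 C : R, 0 <= C &
    forall z, Y z -> `|z.1| <= C /\ `|z.2| <= C.
  move=> /compact_bounded[C [_ HC]]; exists (`|C| + 1); first by rewrite addr_ge0.
  move=> z Yz; have := HC (`|C| + 1) (ltr_pwDr ltr01 (ler_norm _)) z Yz.
  by rewrite /= prod_normE ge_max => /andP[].
have [CA CA0 bA] := bounded _ cA; have [CB CB0 bB] := bounded _ cB.
pose C : R := CA + CB.
have nlA0 : 0 < - lA.1 by rewrite oppr_gt0.
have dl0 : 0 < lB.2 - lA.2 by rewrite subr_gt0.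
(* After [V] periods the horizontal drift exceeds the joint size [C] of the two pieces, and [D]
   bounds the vertical gaps within [V] periods. The lift [K * c] exceeds [D], and after [n] periods
   the relative vertical drift exceeds [D + K * c]. *)
have [V HV] := natr_unbounded _ C nlA0.
pose D : R := C + V%:R * (`|lA.2| + `|lB.2|).
have [K HK] := natr_unbounded _ D c0.
have [n0 Hn0] := natr_unbounded _ (D + K%:R * c) dl0.
pose n := n0.+1.
have Hn : D + K%:R * c < n%:R * (lB.2 - lA.2).
  by apply: lt_trans Hn0 _; rewrite ltr_pM2r ?subr_gt0// ltr_nat.
have Yx : YA x by have [m [p [<- _ pY _]]] := chA 1 ltr01; exact: pY.
have Yy : YB y by have [m [p [<- _ pY _]]] := chB 1 ltr01; exact: pY.
have drift k (t : R) : (k <= V)%N -> `|k%:R * t| <= V%:R * `|t|.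
  by move=> kV; rewrite normrM normr_nat ler_wpM2r// ler_nat.
have far k : (V <= k)%N -> k%:R * lA.1 < - C.
  move=> kV; rewrite -ltrN2 opprK -mulrN; apply: lt_le_trans HV _.
  by rewrite ler_wpM2r ?ler_nat// oppr_ge0 ltW.
pose A := (fun z => translate z (0, c) K) @` spiral YA lA n.
have [||||z [[p Ap pz] Bz]] := @compact_meet _ pt A (spiral YB lB n).
- exact: norm_hausdorff.
- by apply: compact_translate; exact: compact_spiral.
- exact: compact_spiral.
- move=> e e0.
  have e20 : 0 < e / 2 by rewrite divr_gt0.
  have [P [p [p0 pP pY pe]]] := epsilon_chain_spiral _ _ _ _ n0 (chA _ e20).
  have [Q [q [q0 qQ qY qe]]] := epsilon_chain_spiral _ _ _ _ n0 (chB _ e20).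
  have [xC1 xC2] := bA x Yx; have [yC1 yC2] := bB y Yy.
  have sA0 : 0 <= V%:R * `|lA.2| by rewrite mulr_ge0.
  have sB0 : 0 <= V%:R * `|lB.2| by rewrite mulr_ge0.
  move: Hn HK far xC1 xC2 yC1 yC2; rewrite /D /C !ler_norml => Hn HK far.
  move=> /andP[? ?] /andP[? ?] /andP[? ?] /andP[? ?].
  have ptP i : (i <= P)%N -> exists k (a : pt), [/\ (k <= n)%N, p i = translate a lA k,
      - CA <= a.1 <= CA & - CA <= a.2 <= CA].
    move=> /pY[k [a [kn Ya ->]]]; exists k, a; rewrite -!ler_norml.
    by have [] := bA a Ya; split=> //; exact: ltnW.
  have ptQ j : (j <= Q)%N -> exists k (b : pt), [/\ (k <= n)%N, q j = translate b lB k,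
      - CB <= b.1 <= CB & - CB <= b.2 <= CB].
    move=> /qY[k [b [kn Yb ->]]]; exists k, b; rewrite -!ler_norml.
    by have [] := bB b Yb; split=> //; exact: ltnW.
  clear chA chB Yx Yy bA bB cA cB.
  (* The difference of the lifted first chain and the second: a [small] value is an approximate
     crossing. *)
  pose z i j : R * R := ((p i).1 - (q j).1, (p i).2 + K%:R * c - (q j).2).
  have [||||||i [j [iP jQ zij]]] := @grid_zero R P Q z e.
  + by move=> i j iP _; have := pe i iP; rewrite ball_planeE /z /= subl subl2.
  + by move=> i j _ jQ; have := qe j jQ; rewrite ball_planeE /z /= !subr distrC [X in _ /\ X < _]distrC.
  (* On each side one of the two points is an end of its chain. If the other is at least [V] periods
     away from that end, the first coordinates are separated; otherwise the lift, or at the far end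
     the accumulated drift, decides the second ones. *)
  + move=> j /ptQ[k [b [kn qj /andP[? ?] /andP[? ?]]]].
    rewrite /z p0 qj /translate /= lBA.
    case: (leqP V k) => [/far ?|/ltnW /(drift _ lB.2)]; first by left; lra.
    by rewrite ler_norml => /andP[? ?]; right; lra.
  + move=> i /ptP[k [a [kn pi /andP[? ?] /andP[? ?]]]].
    rewrite /z q0 pi /translate /=.
    case: (leqP V k) => [/far ?|/ltnW /(drift _ lA.2)]; first by left; lra.
    by rewrite ler_norml => /andP[? ?]; right; lra.
  + move=> i /ptP[k [a [kn pi /andP[? ?] /andP[? ?]]]].
    rewrite /z qQ pi /translate /= lBA.
    case: (leqP V (n - k)) => [/far|/ltnW /(drift _ lA.2)]; rewrite natrB// -/n.
      by move=> ?; left; lra.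
    by rewrite ler_norml => /andP[? ?]; right; lra.
  + move=> j /ptQ[k [b [kn qj /andP[? ?] /andP[? ?]]]].
    rewrite /z pP qj /translate /= lBA.
    case: (leqP V (n - k)) => [/far|/ltnW /(drift _ lB.2)]; rewrite natrB// -/n.
      by move=> ?; left; lra.
    by rewrite ler_norml => /andP[? ?]; right; lra.
  exists (translate (p i) (0, c) K), (q j); split.
  + by exists (p i) => //; exact: pY.
  + exact: qY.
  + by rewrite ball_planeE /translate /= mulr0 addr0.
- exists n, K, p, z; split=> //; rewrite -pz /translate //=.
  by rewrite mulr0 addr0.
Qed.

End Spirals.

(** * The complex exponential [polar] and its local inverses *)

Definition polar {R : realType} (q : R^o * R^o) : R^o * R^o :=
  (expR q.1 * cos q.2, expR q.1 * sin q.2).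

(* The branch of the complex logarithm at [z] with value [q] at [z0 = polar q];
   meaningful only when [z] and [z0] make an acute angle. *)
Definition log_branch {R : realType} (q z0 z : R^o * R^o) : R^o * R^o :=
  let s := z0.1 ^+ 2 + z0.2 ^+ 2 in
  let u := (z.1 * z0.1 + z.2 * z0.2) / s in
  let v := (z.2 * z0.1 - z.1 * z0.2) / s in
  (q.1 + ln (u ^+ 2 + v ^+ 2) / 2, q.2 + atan (v / u)).

(** A substitute for a lifted path from [x] to [y] over [X]: one compact [Y] serves all [e], so that
    limits can be taken as [e] tends to [0]. *)
Definition log_connected {R : realType} (X : set (R^o * R^o)) (x y : R^o * R^o) :=
  exists2 Y, compact Y & (forall q, Y q -> X (polar q)) /\
    forall e : R, 0 < e -> epsilon_chain Y e x y.

Section Polar.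
Context {R : realType}.
Local Notation pt := (R^o * R^o)%type.
Implicit Types (x y z q : pt) (X Y : set pt).

Lemma cvg_plane {T : topologicalType} (F : set_system T) (f g : T -> R) (a b : R) :
  Filter F -> f @ F --> a -> g @ F --> b ->
  (fun t => (f t, g t) : pt) @ F --> ((a, b) : pt).
Proof.
move=> FF /cvgrPdist_lt fa /cvgrPdist_lt gb; apply/cvg_ballP => e e0.
by apply: filterS2 (fa e e0) (gb e e0) => t ? ?; rewrite ball_planeE.
Qed.

Lemma polarE (r a : R) : 0 < r -> (r * cos a, r * sin a) = polar (ln r, a).
Proof. by move=> r0; rewrite /polar /= lnK ?posrE. Qed.

Lemma polar_sqr q : (polar q).1 ^+ 2 + (polar q).2 ^+ 2 = expR q.1 ^+ 2.
Proof. by rewrite /polar /= !exprMn -mulrDr cos2Dsin2 mulr1. Qed.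

Lemma polar_neq0 q : polar q <> (0, 0).
Proof.
move=> q0; have := polar_sqr q; rewrite q0 /= expr0n /= addr0 => /esym/eqP.
by rewrite sqrf_eq0 gt_eqF ?expR_gt0.
Qed.

Lemma polarD x y : polar (x.1 + y.1, x.2 + y.2) =
  ((polar x).1 * (polar y).1 - (polar x).2 * (polar y).2,
   (polar x).1 * (polar y).2 + (polar x).2 * (polar y).1).
Proof. by rewrite /polar /= expRD cosD sinD; congr (_, _); ring. Qed.

(** The principal logarithm on the right half-plane. With [t = v / u] the modulus is
    [u * Num.sqrt (1 + t ^+ 2)], and the same root is the reciprocal of [cos (atan t)]. *)
Lemma polar_log (u v : R) : 0 < u ->
  polar (ln (u ^+ 2 + v ^+ 2) / 2, atan (v / u)) = (u, v).
Proof.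
move=> u0; set t := v / u; have vE : v = u * t by rewrite /t mulrC divfK ?gt_eqF.
have t1 : 0 < 1 + t ^+ 2 by rewrite ltr_pwDl ?ltr01// sqr_ge0.
have sE : u ^+ 2 + v ^+ 2 = (u * Num.sqrt (1 + t ^+ 2)) ^+ 2.
  by rewrite exprMn sqr_sqrtr ?ltW// vE; ring.
have s0 : 0 < Num.sqrt (1 + t ^+ 2) by rewrite sqrtr_gt0.
have us0 : 0 < u * Num.sqrt (1 + t ^+ 2) by rewrite mulr_gt0.
have cosE : cos (atan t) = (Num.sqrt (1 + t ^+ 2))^-1 by exact: cos_atan.
have sinE : sin (atan t) = t * (Num.sqrt (1 + t ^+ 2))^-1.
  by rewrite -cosE -{2}[t]atanK /tan divfK// cosE invr_eq0 gt_eqF.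
have lnE : ln (u ^+ 2 + v ^+ 2) / 2 = ln (u * Num.sqrt (1 + t ^+ 2)).
  by rewrite sE lnXn// -[_ *+ 2]mulr_natr mulfK// pnatr_eq0.
rewrite /polar /= lnE lnK ?posrE//.
rewrite cosE sinE mulfK ?gt_eqF//; congr (_, _).
by rewrite [X in _ * X]mulrC mulrA mulfK ?gt_eqF.
Qed.

(** The branch is [q] plus the principal logarithm of the complex quotient of [z] by [polar q],
    whose real part is positive by hypothesis. *)
Lemma polar_log_branch q z : 0 < z.1 * (polar q).1 + z.2 * (polar q).2 ->
  polar (log_branch q (polar q) z) = z.
Proof.
move=> uz; set z0 := polar q in uz *; pose s := z0.1 ^+ 2 + z0.2 ^+ 2.
have s0 : 0 < s by rewrite /s /z0 polar_sqr exprn_gt0 ?expR_gt0.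
pose uv : pt := ((z.1 * z0.1 + z.2 * z0.2) / s, (z.2 * z0.1 - z.1 * z0.2) / s).
rewrite -[log_branch _ _ _]/(q.1 + (ln (uv.1 ^+ 2 + uv.2 ^+ 2) / 2, atan (uv.2 / uv.1)).1,
  q.2 + (ln (uv.1 ^+ 2 + uv.2 ^+ 2) / 2, atan (uv.2 / uv.1)).2) polarD -/z0.
rewrite polar_log ?divr_gt0// /uv /=; move: s0; rewrite /s.
by case: z {uz uv} => z1 z2 /= s0; congr (_, _); field; rewrite gt_eqF.
Qed.

Lemma log_branch_refl q : log_branch q (polar q) (polar q) = q.
Proof.
have := exprn_gt0 2 (expR_gt0 q.1); rewrite -polar_sqr /log_branch.
case: (polar q) => a b /= s0; rewrite -!expr2 divff ?gt_eqF// [b * a]mulrC subrr.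
by rewrite !mul0r expr1n expr0n addr0 ln1 atan0 mul0r !addr0; case: (q).
Qed.

Lemma continuous_log_branch q z0 z : 0 < z.1 * z0.1 + z.2 * z0.2 ->
  {for z, continuous (log_branch q z0)}.
Proof.
move=> uz; have z00 : 0 < z0.1 ^+ 2 + z0.2 ^+ 2.
  rewrite lt_neqAle addr_ge0 ?sqr_ge0// andbT eq_sym paddr_eq0 ?sqr_ge0// !sqrf_eq0.
  by apply/negP => /andP[/eqP z1 /eqP z2]; move: uz; rewrite z1 z2 !mulr0 addr0 ltxx.
have c1 : (fun w : pt => w.1 : R) @ z --> (z.1 : R) by exact: cvg_fst.
have c2 : (fun w : pt => w.2 : R) @ z --> (z.2 : R) by exact: cvg_snd.
have cu : (fun w : pt => (w.1 * z0.1 + w.2 * z0.2) / (z0.1 ^+ 2 + z0.2 ^+ 2) : R) @ z -->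
    ((z.1 * z0.1 + z.2 * z0.2) / (z0.1 ^+ 2 + z0.2 ^+ 2) : R).
  by apply: cvgM; [apply: cvgD; apply: cvgM|]; by [exact: cvg_cst|].
have cv : (fun w : pt => (w.2 * z0.1 - w.1 * z0.2) / (z0.1 ^+ 2 + z0.2 ^+ 2) : R) @ z -->
    ((z.2 * z0.1 - z.1 * z0.2) / (z0.1 ^+ 2 + z0.2 ^+ 2) : R).
  by apply: cvgM; [apply: cvgB; apply: cvgM|]; by [exact: cvg_cst|].
have u0 : 0 < (z.1 * z0.1 + z.2 * z0.2) / (z0.1 ^+ 2 + z0.2 ^+ 2) by rewrite divr_gt0.
rewrite /log_branch; apply: cvg_plane.
  apply: cvgD; first exact: cvg_cst.
  apply: cvgM; last exact: cvg_cst.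
  apply: (cvg_comp (fun w : pt => _ : R) (@ln R)); last first.
    by apply: continuous_ln; rewrite ltr_pwDl ?exprn_gt0// sqr_ge0.
  by rewrite /=; apply: cvgD; rewrite expr2; apply: cvgM.
apply: cvgD; first exact: cvg_cst.
apply: (cvg_comp (fun w : pt => _ : R) (@atan R)); last exact: continuous_atan.
by apply: cvgM => //; apply: cvgV => //; rewrite gt_eqF.
Qed.

End Polar.

(** * Lifting pieces of a set through [polar] *)

(** Balls of the plane are squares here, while similarities scale the Euclidean distance; its square
    avoids roots. *)
Definition sqdist {R : realType} (x y : R^o * R^o) : R :=
  (x.1 - y.1) ^+ 2 + (x.2 - y.2) ^+ 2.

Definition sq_lipschitz {R : realType} (c : R) (f : R^o * R^o -> R^o * R^o) :=
  forall x y, sqdist (f x) (f y) <= c * sqdist x y.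

Definition liftable {R : realType} (K : set (R^o * R^o)) (o e : R^o * R^o)
    (f : R^o * R^o -> R^o * R^o) :=
  forall q, polar q = f o ->
    exists2 q', polar q' = f e & log_connected (f @` K) q q'.

Section Lifting.
Context {R : realType}.
Local Notation pt := (R^o * R^o)%type.
Implicit Types (x y z q : pt) (X Y K : set pt) (f : pt -> pt) (c : R).

Lemma sqdist_ge0 x y : 0 <= sqdist x y.
Proof. by rewrite addr_ge0 ?sqr_ge0. Qed.

Lemma ball_sqdist x y (r : R) : 0 < r -> sqdist x y < r ^+ 2 -> ball x r y.
Proof.
move=> r0; rewrite /sqdist ball_planeE => xyr.
have lt_r (t : R) : t ^+ 2 < r ^+ 2 -> `|t| < r.
  by rewrite -(real_normK (num_real t)) ltr_pXn2r ?nnegrE// ltW.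
split; apply: lt_r; apply: le_lt_trans xyr.
  by rewrite lerDl sqr_ge0.
by rewrite lerDr sqr_ge0.
Qed.

Lemma sqdist_ball x y (r : R) : ball x r y -> sqdist x y < 2 * r ^+ 2.
Proof.
rewrite ball_planeE /sqdist => -[x1 x2].
have lt_r (t : R) : `|t| < r -> t ^+ 2 < r ^+ 2.
  by move=> tr; rewrite -(real_normK (num_real t)) ltr_pXn2r// nnegrE// ltW// (le_lt_trans _ tr).
by have := lt_r _ x1; have := lt_r _ x2; lra.
Qed.

Lemma sq_lipschitz_comp c d f g : 0 <= c -> sq_lipschitz c f -> sq_lipschitz d g ->
  sq_lipschitz (c * d) (f \o g).
Proof.
move=> c0 fc gd x y; apply: le_trans (fc _ _) _.
by rewrite -mulrA ler_wpM2l.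
Qed.

Lemma sq_lipschitz_continuous c f : sq_lipschitz c f -> continuous f.
Proof.
move=> fc x; apply/cvg_ballP => e e0.
suff : nbhs (x : pt) (fun z : pt => ball (f x) e (f z)) by [].
pose C := `|c| + 1; have C0 : 0 < C by rewrite ltr_wpDl.
pose d := e / (2 * C); have d0 : 0 < d by rewrite divr_gt0// mulr_gt0.
apply/nbhs_ballP; exists d => //= z /sqdist_ball xz; apply: ball_sqdist => //.
apply: le_lt_trans (fc _ _) _.
have cC : c <= C by rewrite /C (le_trans (ler_norm _))// lerDl.
apply: (@le_lt_trans _ _ (C * sqdist x z)); first by rewrite ler_wpM2r ?sqdist_ge0.
apply: (@lt_le_trans _ _ (C * (2 * d ^+ 2))); first by rewrite ltr_pM2l.
have -> : C * (2 * d ^+ 2) = e ^+ 2 * (1 / (2 * C)).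
  by rewrite /d; field; rewrite gt_eqF.
rewrite ler_piMr ?sqr_ge0// ler_pdivrMr ?mulr_gt0// mul1r.
by rewrite /C; have := normr_ge0 c; lra.
Qed.

Lemma log_connected_sub X Y x y :
  X `<=` Y -> log_connected X x y -> log_connected Y x y.
Proof. by move=> XY [Z cZ [ZX Zxy]]; exists Z => //; split=> // q /ZX/XY. Qed.

Lemma log_connected_trans X x y z :
  log_connected X x y -> log_connected X y z -> log_connected X x z.
Proof.
move=> [Y cY [YX Yxy]] [Z cZ [ZX Zyz]]; exists (Y `|` Z); first exact: compactU.
split=> [q [/YX|/ZX]//|e e0]; apply: (@epsilon_chain_trans _ _ _ _ _ y).
  by apply: epsilon_chain_sub (Yxy e e0) => q; left.
by apply: epsilon_chain_sub (Zyz e e0) => q; right.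
Qed.

(** The whole image lies in the half-plane where a single branch of the logarithm works, and uniform
    continuity carries the chains over. *)
Lemma liftable_acute K (o e : pt) f : compact K -> K o -> K e ->
  (forall r : R, 0 < r -> epsilon_chain K r o e) -> continuous f ->
  (forall x, K x -> 0 < (f x).1 * (f o).1 + (f x).2 * (f o).2) ->
  liftable K o e f.
Proof.
move=> cK Ko Ke chK fcont acute q qo; rewrite -qo in acute.
pose g := log_branch q (polar q) \o f.
have gcont x : K x -> {for x, continuous g}.
  move=> Kx; apply: continuous_comp; first exact: fcont.
  by apply: continuous_log_branch; exact: acute.
have polarg x : K x -> polar (g x) = f x by move=> Kx; rewrite polar_log_branch//; exact: acute.
exists (g e); first exact: polarg.
exists (g @` K).
  by apply: continuous_compact => //; apply: continuous_in_subspaceT => x; rewrite inE; exact: gcont.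
split=> [_ [x Kx <-]|r r0]; first by exists x; rewrite ?polarg.
have <- : g o = q by rewrite /g /= -qo log_branch_refl.
have [d d0 Hd] := compact_unif_continuous _ _ cK gcont _ r0.
by apply: epsilon_chain_image (chK d d0) => u v; exact: Hd.
Qed.

End Lifting.

(** * Subdivision of a self-similar set *)

Section Subdivision.
Context {R : realType}.
Local Notation pt := (R^o * R^o)%type.
Context (N : nat) (S : nat -> pt -> pt) (K : set pt) (o e : pt) (rho : R).
Hypothesis N0 : (0 < N)%N.
Hypothesis rho01 : 0 <= rho < 1.
Hypothesis S_lipschitz : forall j, (1 <= j <= N)%N -> sq_lipschitz rho (S j).
Hypothesis cK : compact K.
Hypothesis Ko : K o.
Hypothesis Ke : K e.
Hypothesis SK : forall j x, (1 <= j <= N)%N -> K x -> K (S j x).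
Hypothesis So : S 1 o = o.
Hypothesis Se : S N e = e.
Hypothesis S_link : forall j, (1 <= j < N)%N -> S j e = S j.+1 o.

(** Each subdivision multiplies the bound on the squared diameter of the image by [rho], so after
    finitely many all pieces fall below [d]. *)
Lemma subdivision_ind (X : set pt) (P : (pt -> pt) -> Prop) (d : R) : 0 < d ->
  (forall f, (forall x, K x -> X (f x)) ->
     (forall j, (1 <= j <= N)%N -> P (f \o S j)) -> P f) ->
  (forall f c, (forall x, K x -> X (f x)) -> sq_lipschitz c f ->
     (forall x y, K x -> K y -> sqdist (f x) (f y) < d) -> P f) ->
  forall f c, 0 <= c -> sq_lipschitz c f -> (forall x, K x -> X (f x)) -> P f.
Proof.
move=> d0 Psub Psmall.
have [D D0 bD] : exists2 D : R, 0 < D & forall x y, K x -> K y -> sqdist x y < D.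
  have /compact_bounded[C [_ HC]] := cK.
  pose C1 := `|C| + 1; have C10 : 0 < C1 by rewrite ltr_wpDl.
  exists (2 * (C1 *+ 2 + 1) ^+ 2); first by rewrite mulr_gt0// exprn_gt0// ltr_wpDl// mulrn_wge0// ltW.
  have bC x : K x -> `|x.1| <= C1 /\ `|x.2| <= C1.
    move=> Kx; have := HC C1 (ltr_pwDr ltr01 (ler_norm _)) x Kx.
    by rewrite /= prod_normE ge_max => /andP[].
  move=> x y /bC[x1 x2] /bC[y1 y2]; apply: sqdist_ball.
  have tri (s t : R) : `|s| <= C1 -> `|t| <= C1 -> `|s - t| < C1 *+ 2 + 1.
    by move=> ? ?; rewrite (le_lt_trans (ler_normB _ _))//; lra.
  by split; exact: tri.
have rec m : forall f c, 0 <= c -> sq_lipschitz c f -> (forall x, K x -> X (f x)) ->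
    c * rho ^+ m * D < d -> P f.
  elim: m => [|m IH] f c c0 fc fX cd.
    apply: (Psmall f c) => // x y Kx Ky; apply: le_lt_trans (fc _ _) _.
    by apply: le_lt_trans cd; rewrite expr0 mulr1 ler_wpM2l// ltW// bD.
  apply: Psub => // j jN; apply: (IH _ (c * rho)).
  - by rewrite mulr_ge0//; case/andP: rho01.
  - by apply: sq_lipschitz_comp => //; exact: S_lipschitz.
  - by move=> x Kx; apply: fX; exact: SK.
  - by move: cd; rewrite exprS mulrA.
move=> f c c0 fc fX.
have : (fun m => c * rho ^+ m * D) @ \oo --> (c * 0 * D : R).
  apply: cvgM; last exact: cvg_cst.
  apply: cvgM; first exact: cvg_cst.
  by apply: cvg_expr; rewrite ger0_norm; case/andP: rho01.
rewrite mulr0 mul0r => /cvgrPdist_lt/(_ d d0)[m _ /(_ m (leqnn m))] /=.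
rewrite sub0r normrN => Hm; apply: (rec m f c) => //.
exact: le_lt_trans (ler_norm _) Hm.
Qed.

(** Pieces of diameter below [r] are crossed in one step, and the link points join the chains of
    consecutive pieces. *)
Lemma epsilon_chain_attractor (r : R) : 0 < r -> epsilon_chain K r o e.
Proof.
move=> r0.
apply: (@subdivision_ind K (fun f => epsilon_chain K r (f o) (f e)) (r ^+ 2) _ _ _ id 1) => //.
- by rewrite exprn_gt0.
- move=> f _ chf; rewrite -{1}So -Se.
  suff H n : (n.+1 <= N)%N -> epsilon_chain K r (f (S 1 o)) (f (S n.+1 e)).
    by rewrite -(prednK N0); apply: H; rewrite prednK.
  elim: n => [n1|n IH n1]; first exact: chf.
  apply: epsilon_chain_trans (IH (ltnW n1)) _.
  by rewrite S_link//; exact: (chf n.+2).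
- move=> f c fK fc small.
  by apply: epsilon_chain_step; [exact: fK|exact: fK|apply: ball_sqdist => //; exact: small].
- by move=> x y; rewrite mul1r.
Qed.

(** The end of the lift of one piece lies over the link point and serves as initial value for the
    next. *)
Lemma liftable_range f a n q : (0 < a)%N -> (a + n <= N)%N ->
  (forall j, (a <= j <= a + n)%N -> liftable K o e (f \o S j)) ->
  polar q = f (S a o) ->
  exists2 q', polar q' = f (S (a + n)%N e) &
    log_connected [set z | exists j x, [/\ (a <= j <= a + n)%N, K x & z = f (S j x)]] q q'.
Proof.
move=> a0; elim: n => [|n IH] anN lift_f qa.
  have [q' q'e cq'] := lift_f a ltac:(by rewrite addn0 leqnn) q qa.
  exists q'; first by rewrite addn0.
  apply: log_connected_sub cq' => _ [x Kx <-]; exists a, x; split=> //.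
  by rewrite addn0 leqnn.
have [||q1 q1e cq1] := IH _ _ qa.
- by apply: leq_trans anN; rewrite leq_add2l.
- by move=> j /andP[aj jan]; apply: lift_f; rewrite aj addnS ltnW.
have q1o : polar q1 = f (S (a + n.+1)%N o).
  by rewrite q1e addnS S_link// -addnS anN andbT addn_gt0 a0.
have [|q2 q2e cq2] := lift_f (a + n.+1)%N _ q1 q1o; first by rewrite leqnn leq_addr.
exists q2 => //; apply: (@log_connected_trans _ _ _ q1).
  apply: log_connected_sub cq1 => _ [j [x [/andP[aj jn] Kx ->]]].
  by exists j, x; split=> //; rewrite aj addnS ltnW.
apply: log_connected_sub cq2 => _ [x Kx <-]; exists (a + n.+1)%N, x; split=> //.
by rewrite leqnn leq_addr.
Qed.

(** By compactness the image stays at squared distance at least [d] from the origin; pieces of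
    squared diameter below [d] are seen from there under an acute angle. *)
Lemma liftable_attractor f c : 0 <= c -> sq_lipschitz c f ->
  (forall x, K x -> f x <> (0, 0)) -> liftable K o e f.
Proof.
move=> c0 fc fn0.
have fcont := sq_lipschitz_continuous _ _ fc.
have [d d0 fd] : exists2 d : R, 0 < d & forall x, K x -> d <= sqdist (f x) (0, 0).
  have [||x Kx xmin] := @compact_EVT_min pt R (fun x => sqdist (f x) (0, 0)) K _ cK.
  - by exists o.
  - apply: continuous_subspaceT => x.
    have c1 : (fun z : pt => (f z).1 : R) @ x --> ((f x).1 : R).
      by apply: cvg_comp; [exact: fcont|exact: cvg_fst].
    have c2 : (fun z : pt => (f z).2 : R) @ x --> ((f x).2 : R).
      by apply: cvg_comp; [exact: fcont|exact: cvg_snd].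
    rewrite /sqdist /=; apply: cvgD; rewrite expr2; apply: cvgM;
      by apply: cvgB => //; exact: cvg_cst.
  exists (sqdist (f x) (0, 0)); last first.
    by move=> y Ky; apply: xmin; rewrite inE.
  rewrite inE in Kx; rewrite lt_neqAle sqdist_ge0 andbT eq_sym; apply/eqP.
  rewrite /sqdist /= !subr0 => /eqP; rewrite paddr_eq0 ?sqr_ge0// !sqrf_eq0.
  move=> /andP[/eqP x1 /eqP x2]; apply: (fn0 _ Kx).
  by move: x1 x2; case: (f x) => ? ? /= -> ->.
apply: (@subdivision_ind [set z | d <= sqdist z (0, 0)] (liftable K o e) d _ _ _ f c) => //.
- move=> g gd subg q qo.
  have N1 : (1 + N.-1 = N)%N by rewrite add1n prednK.
  have [||||q' q'e cq'] := @liftable_range g 1 N.-1 q; rewrite ?N1//.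
  + by rewrite qo So.
  + exists q'; first by rewrite q'e N1 Se.
    apply: log_connected_sub cq' => _ [j [x [jN Kx ->]]].
    by exists (S j x) => //; apply: SK => //; rewrite N1 in jN.
- move=> g c' gd gc small; apply: liftable_acute => //.
  + exact: epsilon_chain_attractor.
  + exact: sq_lipschitz_continuous _ _ gc.
  (* Law of cosines: both squared norms are at least [d] and the squared distance is below [d], so
     the inner product is positive. *)
  + move=> x Kx; have := small x o Kx Ko; have := gd x Kx; have := gd o Ko.
    by rewrite /sqdist /= !subr0 => *; nra.
Qed.

End Subdivision.

(** * Fibres of [polar] *)

Section PolarPeriod.
Context {R : realType}.
Local Notation pt := (R^o * R^o)%type.
Implicit Types q : pt.

Lemma cos_sin_2pi_int (m : int) :
  cos (m%:~R * (2 * pi)) = 1 :> R /\ sin (m%:~R * (2 * pi)) = 0 :> R.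
Proof.
have nat_case (n : nat) : cos (n%:R * (2 * pi)) = 1 :> R /\ sin (n%:R * (2 * pi)) = 0 :> R.
  elim: n => [|n [IHc IHs]]; first by rewrite mul0r cos0 sin0.
  rewrite -natr1 mulrDl mul1r [X in _ + X]mulr_natl.
  by rewrite cosD2pi sinD2pi.
case: m => n; first exact: nat_case.
have [c s] := nat_case n.+1.
by rewrite NegzE mulrNz mulNr cosN sinN c s oppr0.
Qed.

Lemma polar_period q (m : int) : polar (q.1, q.2 + m%:~R * (2 * pi)) = polar q.
Proof.
have [c s] := cos_sin_2pi_int m.
by rewrite /polar /= cosD sinD c s !mulr1 !mulr0 subr0 addr0.
Qed.

(** Reduce [x] to [y] in one period. There [sin y = 0] leaves only [0] and [pi], and the cosine
    excludes [pi]. *)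
Lemma cos_eq1 (x : R) : cos x = 1 -> exists m : int, x = m%:~R * (2 * pi).
Proof.
move=> cx; have p2 : 0 < 2 * pi :> R by rewrite mulr_gt0// pi_gt0.
pose m := Num.floor (x / (2 * pi)); exists m.
have := floor_itv (x / (2 * pi)); rewrite -/m ler_pdivlMr// ltr_pdivrMr// => /andP[mx xm].
pose y := x - m%:~R * (2 * pi).
have xE : x = y + m%:~R * (2 * pi) by rewrite subrK.
have [cm sm] := cos_sin_2pi_int m.
have cy : cos y = 1 by move: cx; rewrite xE cosD cm sm mulr1 mulr0 subr0.
have sy : sin y = 0 by apply: cos1sin0; rewrite cy normr1.
have y0 : 0 <= y by rewrite subr_ge0.
have y2 : y < 2 * pi by move: xm; rewrite intrD mulrDl mul1r /y; lra.
suff y_eq0 : y = 0 by rewrite {1}xE y_eq0 add0r.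
have [yp|yp|yp] := ltgtP y pi.
- apply/eqP; rewrite eq_le y0 andbT leNgt; apply/negP => y_gt0.
  by have := sin_gt0_pi (x := y); rewrite y_gt0 yp sy ltxx => /(_ erefl).
- have := sin_gt0_pi (x := y - pi); rewrite subr_gt0 yp ltrBlDr.
  have -> : pi + pi = 2 * pi :> R by ring.
  rewrite y2 => /(_ erefl).
  by have := sinDpi (y - pi); rewrite subrK sy => /eqP; rewrite eq_sym oppr_eq0 => /eqP ->; rewrite ltxx.
- by have := cospi R; rewrite -yp cy => ?; lra.
Qed.

Lemma polar_inj_period q q' : polar q = polar q' ->
  exists m : int, q' = (q.1, q.2 + m%:~R * (2 * pi)).
Proof.
move=> qq'; have e1 : expR q.1 = expR q'.1.
  have := polar_sqr q; rewrite qq' polar_sqr => /eqP.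
  by rewrite eqrXn2// ?expR_ge0// => /eqP.
move: qq'; rewrite /polar e1 => -[].
have e0 : expR q'.1 != 0 by rewrite gt_eqF// expR_gt0.
move=> /(mulfI e0) cq /(mulfI e0) sq.
have [|m mE] := cos_eq1 (q'.2 - q.2).
  by rewrite cosB cq sq -!expr2 cos2Dsin2.
exists m; rewrite -mE addrC subrK.
by rewrite (expR_inj e1); case: (q').
Qed.

End PolarPeriod.

(** * Similarities and their local picture at a fixed point *)

Section Similarities.
Context {R : realType}.
Local Notation pt := (R^o * R^o)%type.
Implicit Types (x y q b c l : pt) (r a : R) (f : bool).

Lemma sqdist_simil r a f b x y :
  sqdist (simil r a f b x) (simil r a f b y) = r ^+ 2 * sqdist x y.
Proof.
have cs := cos2Dsin2 a; rewrite /sqdist /simil /rot /reflx.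
transitivity (r ^+ 2 * (cos a ^+ 2 + sin a ^+ 2) * sqdist x y); last by rewrite cs mulr1.
by case: f; rewrite /sqdist /=; ring.
Qed.

Lemma sqdist_eq0 x y : sqdist x y = 0 -> x = y.
Proof.
move=> /eqP; rewrite paddr_eq0 ?sqr_ge0// !sqrf_eq0 !subr_eq0 => /andP[/eqP + /eqP].
by case: x y => [? ?] [? ?] /= -> ->.
Qed.

Lemma simil_inj r a f b : r != 0 -> injective (simil r a f b).
Proof.
move=> r0 x y xy; apply: sqdist_eq0; apply/eqP.
have /eqP := sqdist_simil r a f b x y.
by rewrite xy {1}/sqdist !subrr expr0n addr0 eq_sym mulf_eq0 sqrf_eq0 (negbTE r0).
Qed.

Definition centered (T : pt -> pt) c x : pt := ((T x).1 - (T c).1, (T x).2 - (T c).2).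

Lemma sqdist_centered T c x y : sqdist (centered T c x) (centered T c y) = sqdist (T x) (T y).
Proof. by rewrite /sqdist /centered /=; congr (_ ^+ 2 + _ ^+ 2); ring. Qed.

Lemma centered_eq0 T c x : centered T c x = (0, 0) -> T x = T c.
Proof.
rewrite /centered; case: (T x) (T c) => [? ?] [? ?] /= [/eqP + /eqP].
by rewrite !subr_eq0 => /eqP -> /eqP ->.
Qed.

(* The local picture of [T K] at the image of a fixed point [c] of [U] is
   invariant under a rotation by [+-a'] composed with scaling by [r']. *)
Lemma polar_conj r a f b r' a' b' c q x (k : int) : 0 < r' ->
  simil r' a' false b' c = c ->
  polar q = centered (simil r a f b) c x ->
  polar (translate q (ln r', (if f then - a' else a') + k%:~R * (2 * pi)) 1) =
  centered (simil r a f b) c (simil r' a' false b' x).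
Proof.
move=> r0 Uc qx; rewrite /translate /= !mul1r addrA.
rewrite (polar_period (q.1 + ln r', _ + _)).
rewrite (polarD q (ln r', if f then - a' else a')) qx -polarE//.
case: b' c Uc {qx} => b1 b2 [c1 c2]; rewrite /simil /rot /= => -[U1 U2].
(* The fixed-point equation determines the translation vector; what remains is an algebraic
   identity. *)
have -> : b1 = c1 - r' * (cos a' * c1 - sin a' * c2) by lra.
have -> : b2 = c2 - r' * (sin a' * c1 + cos a' * c2) by lra.
by rewrite /centered /simil /rot /reflx; case: f => /=;
  rewrite ?cosN ?sinN; congr (_, _); ring.
Qed.

Lemma polar_conj_spiral r a f b r' a' b' c (K Y : set pt) (k : int) n q : 0 < r' ->
  simil r' a' false b' c = c ->
  (forall x, K x -> K (simil r' a' false b' x)) ->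
  (forall q, Y q -> exists2 x, K x & polar q = centered (simil r a f b) c x) ->
  spiral Y (ln r', (if f then - a' else a') + k%:~R * (2 * pi)) n q ->
  exists2 x, K x & polar q = centered (simil r a f b) c x.
Proof.
move=> r0 Uc UK YK [m [y [_ /YK Yy ->]]] {n}.
elim: m => [|m [x Kx xE]]; first by rewrite translate0.
exists (simil r' a' false b' x); first exact: UK.
by rewrite -[m.+1]addn1 -translateD; apply: polar_conj.
Qed.

(** The iterates of any point of [K] converge to [c], and [K] is closed. *)
Lemma fixed_point_mem (K : set pt) (U : pt -> pt) c (rho : R) :
  K !=set0 -> compact K -> 0 <= rho < 1 -> sq_lipschitz rho U ->
  (forall x, K x -> K (U x)) -> U c = c -> K c.
Proof.
move=> [x Kx] cK /andP[rho0 rho1] Ulip UK Uc.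
have cl : closed K by apply: compact_closed => //; exact: norm_hausdorff.
apply: cl => B /nbhs_ballP[e /= e0 eB].
have Kn n : K (iter n U x) by elim: n => //= n; exact: UK.
have dist n : sqdist c (iter n U x) <= rho ^+ n * sqdist c x.
  elim: n => [|n IH]; first by rewrite mul1r.
  rewrite /= -{1}Uc exprS -mulrA; apply: le_trans (Ulip _ _) _.
  by rewrite ler_wpM2l.
have : (fun m => rho ^+ m * sqdist c x) @ \oo --> (0 * sqdist c x : R).
  by apply: cvgM; [apply: cvg_expr; rewrite ger0_norm|exact: cvg_cst].
rewrite mul0r => /cvgrPdist_lt/(_ (e ^+ 2) (exprn_gt0 2 e0))[m _ /(_ m (leqnn m))] /=.
rewrite sub0r normrN => Hm; exists (iter m U x); split; first exact: Kn.
apply: eB; apply: ball_sqdist => //; apply: le_lt_trans (dist m) _.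
exact: le_lt_trans (ler_norm _) Hm.
Qed.

End Similarities.

(** * Crossing of two logarithmic spirals around a point *)

(** Grouping [s] periods of one curve and [t] of the other equalizes the horizontal drifts. The
    order of the vertical drifts decides which curve is lifted, and [polar] does not see a lift by
    multiples of [2 * pi]. *)
Lemma spirals_polar_meet {R : realType} (YA YB : set (R^o * R^o)) (x y lA lB : R^o * R^o)
    (s t : nat) :
  compact YA -> compact YB ->
  (forall e : R, 0 < e -> epsilon_chain YA e x (translate x lA 1)) ->
  (forall e : R, 0 < e -> epsilon_chain YB e y (translate y lB 1)) ->
  (0 < s)%N -> (0 < t)%N -> lA.1 < 0 ->
  s%:R * lA.1 = t%:R * lB.1 -> s%:R * lA.2 != t%:R * lB.2 ->
  exists n p q, [/\ spiral YA lA n p, spiral YB lB n q & polar p = polar q].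
Proof.
move=> cA cB chA chB s0 t0 lA0 e1 ne2.
pose mul (n : nat) (l : R^o * R^o) : R^o * R^o := (n%:R * l.1, n%:R * l.2).
have mulE z l n : translate z (mul n l) 1 = translate z l n.
  by rewrite /translate /= !mul1r.
have cA' := compact_spiral YA lA s cA; have cB' := compact_spiral YB lB t cB.
have chA' e : 0 < e -> epsilon_chain (spiral YA lA s) e x (translate x (mul s lA) 1).
  by move=> /chA/(epsilon_chain_spiral _ _ _ _ s.-1); rewrite prednK// mulE.
have chB' e : 0 < e -> epsilon_chain (spiral YB lB t) e y (translate y (mul t lB) 1).
  by move=> /chB/(epsilon_chain_spiral _ _ _ _ t.-1); rewrite prednK// mulE.
have slA0 : (mul s lA).1 < 0 by rewrite /= pmulr_rlt0// ltr0n.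
have tlB0 : (mul t lB).1 < 0 by rewrite /= -e1.
have c0 : 0 < 2 * pi :> R by rewrite mulr_gt0// pi_gt0.
have period (p q : R^o * R^o) (k : nat) : p.1 = q.1 -> p.2 + k%:R * (2 * pi) = q.2 ->
    polar p = polar q.
  by move=> pq1 pq2; rewrite -(polar_period p k) pq1 pq2; case: (q).
have grow Y l m n : (m <= n)%N -> spiral Y l m `<=` spiral Y l n.
  by move=> mn z [k [w [km Yw ->]]]; exists k, w; split=> //; exact: leq_trans mn.
have [lt_AB|lt_BA|//] := ltgtP (mul s lA).2 (mul t lB).2; last first.
- by move=> e2; move: ne2; rewrite -[_ * lA.2]/((mul s lA).2) e2 eqxx.
- have [n [k [p [q [Bp Aq pq1 pq2]]]]] :=
    spirals_meet _ _ _ _ _ _ _ cB' cA' c0 chB' chA' tlB0 e1 lt_BA.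
  exists (s * n + t * n)%N, q, p; split.
  + by apply: grow (spiral_spiral _ _ _ _ _ Aq); exact: leq_addr.
  + by apply: grow (spiral_spiral _ _ _ _ _ Bp); exact: leq_addl.
  + by apply/esym; apply: period pq2.
- have [n [k [p [q [Ap Bq pq1 pq2]]]]] :=
    spirals_meet _ _ _ _ _ _ _ cA' cB' c0 chA' chB' slA0 (esym e1) lt_AB.
  exists (s * n + t * n)%N, p, q; split.
  + by apply: grow (spiral_spiral _ _ _ _ _ Ap); exact: leq_addr.
  + by apply: grow (spiral_spiral _ _ _ _ _ Bq); exact: leq_addl.
  + exact: period pq2.
Qed.

(** * Application to the two pieces meeting at a link point *)

Lemma uniform_ratio {R : realType} (N : nat) (r : nat -> R) :
  (forall j, (1 <= j <= N)%N -> 0 < r j < 1) ->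
  exists2 rho : R, 0 <= rho < 1 & forall j, (1 <= j <= N)%N -> r j ^+ 2 <= rho.
Proof.
elim: N => [|N IH] r01; first by exists 0 => [|j]; [rewrite lexx ltr01|lia].
have [|rho /andP[rho0 rho1] Hrho] := IH.
  by move=> j /andP[j0 jN]; apply: r01; rewrite j0 ltnW.
have /andP[r0 r1] : 0 < r N.+1 < 1 by apply: r01; rewrite ltnS leqnn.
have rr : r N.+1 ^+ 2 < 1 by rewrite expr_lt1// ltW.
exists (Num.max rho (r N.+1 ^+ 2)); first by rewrite le_max rho0 gt_max rho1.
move=> j /andP[j0]; rewrite leq_eqVlt => /orP[/eqP->|jN]; rewrite le_max ?lexx ?orbT//.
by rewrite Hrho// j0.
Qed.

Theorem theorem1p7 (R : realType) (N : nat) (r alpha : nat -> R)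
  (refl : nat -> bool) (b : nat -> (R^o * R^o)%type) (gamma : set ((R^o * R^o)%type)) :
  normalized_IFS_path N r alpha refl b gamma ->
  (* (1) S_1 and S_N orientation preserving *)
  refl 1%N = false -> refl N = false ->
  (* (2) *)
  (exists t s : nat, r 1%N ^+ t = r N ^+ s /\
     forall q : rat, t%:R * alpha 1%N - s%:R * alpha N != 2 * pi * ratr q) ->
  (* (3) *)
  (exists i : nat, (1 <= i < N)%N /\
     refl i = refl i.+1 /\
     let p := Sim r alpha refl b i (e1 R) in
     (forall theta : R,
        ~ (rot_about p theta @` (Sim r alpha refl b i @` gamma)
             `<=` Sim r alpha refl b i.+1 @` gamma)) /\
     (forall theta : R,
        ~ (rot_about p theta @` (Sim r alpha refl b i.+1 @` gamma)
             `<=` Sim r alpha refl b i @` gamma))) ->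
  ~ IFS_arc N r alpha refl b gamma.
Proof.
move=> _ refl1 reflN [t [s [rts irr]]] [i [/andP[i0 iN] [reflE _]]].
move=> [[[N2 rN] [[gamma0 [cK Kinv]] [S1o [SNe link]]]] [meet disj]].
set S := Sim r alpha refl b in Kinv S1o SNe link meet disj.
set o := origin R in S1o link meet; set e := e1 R in SNe link.
have N0 : (0 < N)%N by exact: ltnW.
have r01 j : (1 <= j <= N)%N -> 0 < r j < 1 by case/rN.
have [rho rho01 rho_r] := uniform_ratio N r r01.
have S_lip j : (1 <= j <= N)%N -> sq_lipschitz rho (S j).
  by move=> jN x y; rewrite sqdist_simil ler_wpM2r ?sqdist_ge0// rho_r.
have SK j x : (1 <= j <= N)%N -> gamma x -> gamma (S j x).
  by move=> jN Kx; rewrite Kinv; exists j; split=> //; exists x.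
have in1 : (1 <= 1 <= N)%N by [].
have inN : (1 <= N <= N)%N by rewrite N0 leqnn.
have ini : (1 <= i <= N)%N by rewrite i0 ltnW.
have ini1 : (1 <= i.+1 <= N)%N by [].
have Ko : gamma o.
  by apply: (fixed_point_mem _ _ _ _ gamma0 cK rho01 (S_lip _ in1) _ S1o) => x; exact: SK.
have Ke : gamma e.
  by apply: (fixed_point_mem _ _ _ _ gamma0 cK rho01 (S_lip _ inN) _ SNe) => x; exact: SK.
have r_neq0 j : (1 <= j <= N)%N -> r j != 0 by move=> /r01/andP[/gt_eqF ->].
have S_inj j : (1 <= j <= N)%N -> injective (S j).
  by move=> /r_neq0 ? ; exact: simil_inj.
have oe : o <> e by move=> [/eqP]; rewrite eq_sym oner_eq0.
(* In an arc only the first piece contains [o]: the second meets it at [S 1 e] alone, which differs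
   from [o = S 1 o] by injectivity. Hence the other pieces can be lifted around [o]. *)
have o_notin j x : (2 <= j <= N)%N -> gamma x -> S j x <> o.
  move=> /andP[j2 jN] Kx Sjx.
  have [j3|j3] := ltnP 2 j.
    have := disj 1%N j in1 ltac:(by rewrite jN ltnW) (or_introl j3).
    by apply/eqP/set0P; exists o; split; [exists o|exists x].
  have jE : j = 2%N by apply/eqP; rewrite eqn_leq j3.
  have : ((S 1%N @` gamma) `&` (S 2 @` gamma)) o.
    by rewrite jE in Sjx; split; [exists o|exists x].
  by rewrite meet//= -link// => So; apply: oe; apply: (S_inj 1%N in1); rewrite -So.
(* Symmetrically, only the last piece contains [e]. *)
have e_notin j x : (1 <= j < N)%N -> gamma x -> S j x <> e.
  move=> /andP[j1 jN] Kx Sjx.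
  have [j3|j3] := ltnP j.+1 N.
    have := disj j N ltac:(by rewrite j1 ltnW) inN (or_introl j3).
    by apply/eqP/set0P; exists e; split; [exists x|exists e].
  have jE : j.+1 = N by apply/eqP; rewrite eqn_leq j3 jN.
  have : ((S j @` gamma) `&` (S j.+1 @` gamma)) e.
    by split; [exists x|exists e => //; rewrite jE].
  rewrite meet ?j1//= jE => eo; apply: oe; apply: (S_inj N inN).
  by rewrite -eo SNe.
have lift_centered k c j : (1 <= k <= N)%N -> (1 <= j <= N)%N ->
    (forall x, gamma x -> S j x <> c) -> liftable gamma o e (centered (S k) c \o S j).
  move=> kN jN jc.
  have lipF : sq_lipschitz ((r k * r j) ^+ 2) (centered (S k) c \o S j).
    by move=> x y; rewrite /= sqdist_centered !sqdist_simil exprMn mulrA.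
  apply: (liftable_attractor N S gamma o e rho N0 rho01 S_lip cK Ko Ke SK S1o SNe link
    _ _ (sqr_ge0 _) lipF).
  by move=> x Kx /centered_eq0 /(S_inj k kN); exact: jc.
have r_gt0 j : (1 <= j <= N)%N -> 0 < r j by move=> /r01/andP[].
have S1E : S 1%N = simil (r 1%N) (alpha 1%N) false (b 1%N) by rewrite /S /Sim refl1.
have SNE : S N = simil (r N) (alpha N) false (b N) by rewrite /S /Sim reflN.
(* A reflection in [S i] reverses angles; by (3a) the same sign serves [S i.+1]. *)
pose sg a : R := if refl i then - a else a.
(* Pieces [2] to [N] form a fundamental domain of [S 1] at [o], leading from [S 2 o = S 1 e] to [e].
   Their lift under [S i.+1] joins a point to its translate by one period. *)
have [YB [mB [y [cYB YBK chB]]]] : exists YB (m : int) y, [/\ compact YB,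
    forall q, YB q -> exists2 x, gamma x & polar q = centered (S i.+1) o x &
    forall u : R, 0 < u -> epsilon_chain YB u y
      (translate y (ln (r 1%N), sg (alpha 1%N) + m%:~R * (2 * pi)) 1)].
  pose qe : R^o * R^o := (ln (r i.+1), alpha i.+1).
  have qeE : polar qe = centered (S i.+1) o e.
    rewrite /polar /= lnK ?posrE ?r_gt0//.
    by rewrite /centered /S /Sim /simil /rot /reflx /e /o /e1 /origin; case: (refl _) => /=;
      congr (_, _); ring.
  pose q0 := translate qe (ln (r 1%N), sg (alpha 1%N) + 0%:~R * (2 * pi)) 1.
  have q0E : polar q0 = centered (S i.+1) o (S 2 o).
    rewrite -link// S1E /q0 /sg reflE.
    by apply: polar_conj => //; [exact: r_gt0|rewrite -S1E].
  have [||||q' q'E [Y cY [YX Ych]]] :=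
    liftable_range N S gamma o e link (centered (S i.+1) o) 2 (N - 2) q0.
  - by [].
  - by rewrite subnKC.
  - rewrite subnKC// => j jN; apply: lift_centered => //; first by case/andP: jN => /ltnW ->.
    by move=> x; exact: o_notin.
  - exact: q0E.
  rewrite subnKC// in q'E YX; rewrite SNe -qeE in q'E.
  have [m mE] := polar_inj_period _ _ (esym q'E).
  (* The lift from [q0] ends [m] turns above [qe]; the chain is reversed so as to go from [q']
     inwards to [q0], which costs [- m] turns. *)
  exists Y, (- m), q'; split=> //.
    move=> q /YX[j [x [/andP[j2 jN] Kx ->]]]; exists (S j x) => //.
    by apply: SK => //; rewrite jN ltnW.
  move=> u u0; have -> : translate q' (ln (r 1%N), sg (alpha 1%N) + (- m)%:~R * (2 * pi)) 1 = q0.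
    by rewrite mE /q0 /translate /= rmorphN /= mulr0z; congr (_, _); ring.
  exact/epsilon_chain_sym/Ych.
(* Likewise pieces [1] to [N - 1] form a fundamental domain of [S N] at [e], leading from [o] to
   [S N o]. *)
have [YA [mA [x [cYA YAK chA]]]] : exists YA (m : int) x, [/\ compact YA,
    forall q, YA q -> exists2 x, gamma x & polar q = centered (S i) e x &
    forall u : R, 0 < u -> epsilon_chain YA u x
      (translate x (ln (r N), sg (alpha N) + m%:~R * (2 * pi)) 1)].
  (* Seen from [S i e], the point [S i o] lies in the direction opposite to angle [alpha i]. *)
  pose q0 : R^o * R^o := (ln (r i), alpha i + pi).
  have q0E : polar q0 = centered (S i) e o.
    rewrite /polar /= lnK ?posrE ?r_gt0// cosDpi sinDpi.
    by rewrite /centered /S /Sim /simil /rot /reflx /e /o /e1 /origin; case: (refl _) => /=;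
      congr (_, _); ring.
  pose q1 := translate q0 (ln (r N), sg (alpha N) + 0%:~R * (2 * pi)) 1.
  have q1E : polar q1 = centered (S i) e (S N o).
    by rewrite SNE; apply: polar_conj => //; [exact: r_gt0|rewrite -SNE].
  have NE : (1 + (N - 2)).+1 = N by lia.
  have [||||q' q'E [Y cY [YX Ych]]] :=
    liftable_range N S gamma o e link (centered (S i) e) 1 (N - 2) q0.
  - by [].
  - by rewrite -ltnS NE.
  - move=> j /andP[j1 jN]; rewrite -ltnS NE in jN.
    apply: lift_centered => //; first by rewrite j1 ltnW.
    by move=> x Kx; apply: e_notin => //; rewrite j1.
  - by rewrite q0E S1o.
  rewrite link in q'E; last by lia.
  rewrite NE -q1E in q'E.
  have [m mE] := polar_inj_period _ _ (esym q'E).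
  exists Y, m, q0; split=> //.
    move=> q /YX[j [x [/andP[j1 jN] Kx ->]]]; rewrite -ltnS NE in jN; exists (S j x) => //.
    by apply: SK => //; rewrite j1 ltnW.
  move=> u u0; have -> : translate q0 (ln (r N), sg (alpha N) + m%:~R * (2 * pi)) 1 = q'.
    by rewrite mE /q1 /translate /= mulr0z; congr (_, _); ring.
  exact: Ych.
(* If both exponents vanished, the angle combination would be [0]; if only one did, a positive power
   of a ratio below [1] would equal [1]. *)
have [s0 t0] : (0 < s)%N /\ (0 < t)%N.
  have rX j n : (1 <= j <= N)%N -> r j ^+ n = 1 -> n = 0%N.
    move=> /r01/andP[rj0 rj1]; case: n => // n rn.
    by have := expr_lt1 (ltn0Sn n) (ltW rj0); rewrite rn rj1 ltxx.
  have nontrivial : ~ (s = 0%N /\ t = 0%N).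
    by move=> [s0 t0]; have := irr 0; rewrite s0 t0 !mul0r subrr rmorph0 mulr0 eqxx.
  split; rewrite lt0n; apply/eqP => z0; apply: nontrivial; split=> //.
    by apply: (rX 1%N) => //; rewrite rts z0.
  by apply: (rX N) => //; rewrite -rts z0.
have lA0 : ln (r N) < 0 by rewrite ln_lt0// r01.
have rates : s%:R * ln (r N) = t%:R * ln (r 1%N).
  by rewrite !mulr_natl -!lnXn ?r_gt0// rts.
(* Equality would make [t * alpha 1 - s * alpha N] equal to [2 * pi] times the integer [k'],
   contrary to (2). *)
have twist : s%:R * (sg (alpha N) + mA%:~R * (2 * pi)) !=
    t%:R * (sg (alpha 1%N) + mB%:~R * (2 * pi)).
  apply/eqP => E; pose k : int := s%:Z * mA - t%:Z * mB.
  have kE : (k%:~R : R) = s%:R * mA%:~R - t%:R * mB%:~R.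
    by rewrite /k rmorphB /= !rmorphM.
  pose k' : int := if refl i then - k else k.
  have /eqP := irr k'%:~R; apply; rewrite ratr_int /k'; move: E; rewrite /sg.
  by case: (refl i) => E; rewrite ?rmorphN /= kE; lra.
have [n [q [q' [Aq Bq' qq']]]] :=
  spirals_polar_meet YA YB x y _ _ s t cYA cYB chA chB s0 t0 lA0 rates twist.
have [u Ku qu] : exists2 u, gamma u & polar q = centered (S i) e u.
  apply: (polar_conj_spiral (r i) (alpha i) (refl i) (b i) _ _ (b N) e gamma YA mA n q (r_gt0 N inN) _ _ YAK Aq).
    by rewrite -SNE.
  by move=> z Kz; rewrite -SNE; exact: SK.
have [v Kv qv] : exists2 v, gamma v & polar q' = centered (S i.+1) o v.
  apply: (polar_conj_spiral (r i.+1) (alpha i.+1) (refl i.+1) (b i.+1) (r 1%N) (alpha 1%N)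
    (b 1%N) o gamma YB mB n q' (r_gt0 1%N in1) _ _ YBK).
  - by rewrite -S1E.
  - by move=> z Kz; rewrite -S1E; exact: SK.
  - by rewrite -reflE.
(* Both local pictures are centred at the link point, so equal [polar] values give a common point.
   It is not the link point because [polar] never vanishes. *)
have uv : S i u = S i.+1 v.
  move: qq'; rewrite qu qv /centered link ?i0//.
  case: (S i u) (S i.+1 v) => [u1 u2] [v1 v2] /= [/addIr -> /addIr ->].
  by [].
have : ((S i @` gamma) `&` (S i.+1 @` gamma)) (S i u) by split; [exists u|exists v].
rewrite meet ?i0//= => uo; apply: (polar_neq0 q).
by rewrite qu /centered uo link ?i0// !subrr.
Qed.
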